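(* Let $n\geq 7$ be an odd integer, let $0\leq k\leq 3$ be an integer, and let $G\in \mathfrak{C}_{n,k}\left(\frac{n-1}{2}\right)$. Then $W(G)\leq W(C_n)$.
   Context: All graphs are finite, connected, undirected, without loops or parallel edges. The Wiener index $W(G)$ of a graph $G$ is the sum of the distances between all unordered pairs of vertices of $G$. A cut vertex of $G$ is a vertex whose removal makes the graph disconnected. $\mathfrak{C}_{n,k}(d)$ denotes the family of all (connected) graphs on $n$ vertices with exactly $k$ cut vertices and diameter $d$. $C_n$ is the cycle on $n$ vertices. *)

(* Defs.v *)
From mathcomp Require Import all_boot.

Set Implicit Arguments.
Unset Strict Implicit.
Unset Printing Implicit Defensive.

Record sgraph := SGraph {
  vertex :> finType;
  adj : rel vertex;
  adj_sym : symmetric adj;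
  adj_irrefl : irreflexive adj
}.

Section Graph.
Variable G : sgraph.

Definition connected : bool := [forall x : G, forall y : G, connect (@adj G) x y].

Definition has_walk (x y : G) (l : nat) : bool :=
  [exists p : l.-tuple G, path (@adj G) x p && (last x p == y)].

(* Two vertices joined by a walk are joined by one of length less than #|G|,  *)
(* so this is the least length of a walk from x to y; if there is no walk,    *)
(* the value is #|G|.                                                         *)
Definition dist (x y : G) : nat := find (has_walk x y) (iota 0 #|G|).

Definition diameter : nat := \max_(x : G) \max_(y : G) dist x y.

(* enum_rank selects one ordered pair for each unordered pair of vertices.    *)
Definition wiener : nat :=
  \sum_(x : G) \sum_(y : G | enum_rank x < enum_rank y) dist x y.

End Graph.

Section Induced.
Variables (G : sgraph) (A : {set G}).

Definition induced_adj : rel {x : G | x \in A} := relpre val (@adj G).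

Lemma induced_adj_sym : symmetric induced_adj.
Proof. by move=> x y; apply: adj_sym. Qed.

Lemma induced_adj_irrefl : irreflexive induced_adj.
Proof. by move=> x; apply: adj_irrefl. Qed.

Definition induced : sgraph := SGraph induced_adj_sym induced_adj_irrefl.

End Induced.

Definition cut_vertex (G : sgraph) (v : G) : bool := ~~ connected (induced [set~ v]).

Definition cut_vertex_family (n k d : nat) (G : sgraph) : Prop :=
  [/\ connected G, #|G| = n, #|[set v : G | cut_vertex v]| = k & diameter G = d].

(* The test i != j only matters for n = 1, where ordS i = i.                  *)
Definition cycle_adj (n : nat) : rel 'I_n :=
  [rel i j | (i != j) && ((ordS i == j) || (ordS j == i))].

Lemma cycle_adj_sym n : symmetric (@cycle_adj n).
Proof. by move=> i j; rewrite /cycle_adj /= eq_sym orbC. Qed.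

Lemma cycle_adj_irrefl n : irreflexive (@cycle_adj n).
Proof. by move=> i; rewrite /cycle_adj /= eqxx. Qed.

Definition cycle_graph (n : nat) : sgraph :=
  SGraph (@cycle_adj_sym n) (@cycle_adj_irrefl n).

(* Main.v *)
Require Import Defs.
From mathcomp Require Import all_boot ssralg zmodp zify.

Set Implicit Arguments.
Unset Strict Implicit.
Unset Printing Implicit Defensive.

(* Write n = 2d + 1. A singleton distance layer around v, strictly between v
   and its eccentricity e, is a cut vertex, so a set of m vertices with s cut
   vertices other than v satisfies t + e^2 <= e m + (e - 1) + ... + (e - s),
   where t is the sum of the distances from v. If a cut vertex c separates Y
   from Z, both containing c, the sum S of all distances over ordered pairs
   satisfies S(Y u Z) = S(Y) + S(Z) + 2 (|Z| - 1) t_Y(c) + 2 (|Y| - 1) t_Z(c).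
   Cutting at c so that one component at c is as large as possible leaves a
   side Z whose only possible cut vertex is c, and a side Y with fewer cut
   vertices. Induction bounds S for at most two cut vertices by m floor(m^2/4)
   plus a small excess. The diameter only enters in the last cut, where the
   eccentricities of c in Y and Z add up to at most d: for d >= 8 a polynomial
   estimate suffices, and for smaller d finitely many numerical cases remain.
   The case d = 3 with three cut vertices escapes this bound and is done by
   hand. In C_n every vertex has transmission d (d + 1). *)

(** * Distances as lengths of shortest walks *)

Section Distance.
Variable G : sgraph.
Implicit Types x y z : G.

Lemma has_walkP x y l :
  reflect (exists p, [/\ path (@adj G) x p, last x p = y & size p = l])
          (has_walk x y l).
Proof.
apply: (iffP existsP) => [[p /andP[xp /eqP px]]|[p [xp px sp]]].
  by exists p; rewrite size_tuple.
have sp' : size p == l by apply/eqP.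
by exists (Tuple sp'); rewrite /= xp px eqxx.
Qed.

Lemma dist_le_card x y : dist x y <= #|G|.
Proof. by rewrite -[X in _ <= X](size_iota 0) find_size. Qed.

Lemma dist_le_walk x y p : path (@adj G) x p -> last x p = y -> dist x y <= size p.
Proof.
move=> xp px; case: (leqP #|G| (size p)) => [|lt_pG].
  exact: leq_trans (dist_le_card x y).
rewrite leqNgt; apply/negP => lt_p.
have := before_find 0 lt_p; rewrite nth_iota // => /negbT/negP; apply.
by apply/has_walkP; exists p.
Qed.

Lemma has_walk_sym x y l : has_walk x y l = has_walk y x l.
Proof.
have walk_rev (u v : G) : has_walk u v l -> has_walk v u l.
  case/has_walkP => [p [up pv <-]]; apply/has_walkP; exists (rev (belast u p)).
  rewrite size_rev size_belast -pv rev_path; split=> //; last first.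
    by case: p {up pv} => //= w p; rewrite rev_cons last_rcons.
  by rewrite (@eq_path _ _ (@adj G)) // => a b; apply: adj_sym.
by apply/idP/idP; apply: walk_rev.
Qed.

Lemma dist_sym x y : dist x y = dist y x.
Proof. by apply: eq_find => l; apply: has_walk_sym. Qed.

Lemma dist_xx x : dist x x = 0.
Proof. by apply/eqP; rewrite -leqn0 -[0]/(size (Nil G)) dist_le_walk. Qed.

Lemma adj_dist x y : adj x y -> dist x y <= 1.
Proof.
by move=> xy; rewrite -[1]/(size [:: y]) dist_le_walk //= xy.
Qed.

Hypothesis conG : connected G.

Lemma dist_walk x y :
  exists p, [/\ path (@adj G) x p, last x p = y & size p = dist x y].
Proof.
apply/has_walkP; have /forallP/(_ x)/forallP/(_ y)/connectP[p0 xp0 ->] := conG.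
(* [dist] searches only lengths below [#|G|], so the walk is first freed of repeated vertices. *)
case: (shortenP xp0) => p xp Up _.
have lt_pG : size p < #|G|.
  by rewrite -[(size p).+1]/(size (x :: p)) -(card_uniqP Up) max_card.
have hw : has (has_walk x (last x p)) (iota 0 #|G|).
  apply/hasP; exists (size p); first by rewrite mem_iota.
  by apply/has_walkP; exists p.
have := nth_find 0 hw; rewrite nth_iota //.
by move: hw; rewrite has_find size_iota.
Qed.

Lemma dist_eq0 x y : (dist x y == 0) = (x == y).
Proof.
apply/eqP/eqP => [d0|->]; last exact: dist_xx.
by case: (dist_walk x y) => p []; rewrite d0 => _ <- /size0nil->.
Qed.

Lemma dist_triangle x y z : dist x z <= dist x y + dist y z.
Proof.
case: (dist_walk x y) => p [xp px <-]; case: (dist_walk y z) => q [yq qz <-].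
by rewrite -size_cat dist_le_walk // ?cat_path ?last_cat px // xp.
Qed.

Lemma dist_pred x y : x != y -> exists2 z, adj z y & (dist x z).+1 = dist x y.
Proof.
case: (dist_walk x y) => p [].
case: (lastP p) => [_ <-|q z]; first by rewrite eqxx.
rewrite rcons_path last_rcons size_rcons => /andP[xq qz] zy sq _; subst z.
exists (last x q) => //; have := dist_le_walk xq erefl.
have := dist_triangle x (last x q) y; have := adj_dist qz; lia.
Qed.

End Distance.

(** * Cut vertices and separations inside vertex sets *)

Section CutVertices.
Variable G : sgraph.
Hypothesis conG : connected G.
Implicit Types (x y z u v w c : G) (A X Y Z : {set G}).

Definition joined A : rel G :=
  connect [rel x y | [&& x \in A, y \in A & adj x y]].

(** Shortest paths of [G] between vertices of [X] can be found inside [X]; thus distances stay those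
    of [G] while the set is cut into smaller pieces. *)
Definition geodesic X : Prop :=
  forall x y, x \in X -> y \in X -> x != y ->
  exists2 z, z \in X & adj z y /\ (dist x z).+1 = dist x y.

Definition cut_in X w : bool :=
  (w \in X) &&
  [exists x in X :\ w, exists y in X :\ w, ~~ joined (X :\ w) x y].

Definition cuts X : {set G} := [set w | cut_in X w].

Definition separates X c Y Z : Prop :=
  [/\ Y :|: Z = X, Y :&: Z = [set c]
    & forall y z, y \in Y -> z \in Z -> adj y z -> (y == c) || (z == c)].

Lemma joined_sym A : connect_sym [rel x y | [&& x \in A, y \in A & adj x y]].
Proof.
by apply: sym_connect_sym => x y /=; rewrite adj_sym andbCA.
Qed.

(** Discrete intermediate value argument: [f] rises by at most one along an edge, so a path cannot
    skip the value [i]. *)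
Lemma joined_crossing A (f : G -> nat) i x y :
  (forall u v, adj u v -> f v <= (f u).+1) ->
  x \in A -> joined A x y -> f x <= i <= f y -> exists2 z, z \in A & f z = i.
Proof.
move=> f_lip xA /connectP[p xp ->] {y}.
elim: p x xA xp => [|z p IHp] x xA /=.
  by move=> _ /andP[fxi ifx]; exists x => //; apply/eqP; rewrite eqn_leq fxi.
case/andP=> /and3P[_ zA xz] zp /andP[fxi ifp].
have [fzi|lt_ifz] := leqP (f z) i; first by apply: (IHp z) => //; apply/andP.
by exists x => //; apply/eqP; rewrite eqn_leq fxi -ltnS (leq_trans lt_ifz (f_lip _ _ xz)).
Qed.

Lemma dist_lip v x y : adj x y -> dist v y <= (dist v x).+1.
Proof.
by move=> xy; rewrite -addn1 (leq_trans (dist_triangle conG _ x _)) // leq_add2l adj_dist.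
Qed.

(** A path from [v] to [u] avoiding [w] would have to cross the layer of [w], which contains nothing
    else. *)
Lemma single_layer_cut X v w u :
  v \in X -> w \in X -> u \in X -> v != w ->
  (forall x, x \in X -> dist v x = dist v w -> x = w) ->
  dist v w < dist v u -> cut_in X w.
Proof.
move=> vX wX uX vw single lt_wu; rewrite /cut_in wX.
have uw : u != w by apply: contraTneq lt_wu => ->; rewrite ltnn.
have vXw : v \in X :\ w by rewrite !inE vw.
apply/existsP; exists v; rewrite vXw; apply/existsP; exists u.
rewrite !inE uw uX; apply/negP => vu.
have [|z] := joined_crossing (i := dist v w) (@dist_lip v) vXw vu.
  by rewrite dist_xx leq0n ltnW.
by rewrite !inE => /andP[zw zX] /(single z zX) zw'; rewrite zw' eqxx in zw.
Qed.

Lemma geodesic_setT : geodesic [set: G].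
Proof.
by move=> x y _ _ /(dist_pred conG)[z zy dz]; exists z; rewrite ?inE.
Qed.

Lemma geodesic_joined X x y : geodesic X -> x \in X -> y \in X -> joined X x y.
Proof.
move=> gX xX; have [n] := ubnP (dist x y); elim: n y => // n IHn y le_n yX.
have [->|xy] := eqVneq x y; first exact: connect0.
have [z zX [zy dz]] := gX _ _ xX yX xy.
apply: (connect_trans (IHn z _ zX)); first by rewrite -dz in le_n.
by apply: connect1; rewrite /= zX yX.
Qed.

Lemma sub_joined A1 A2 x y : A1 \subset A2 -> joined A1 x y -> joined A2 x y.
Proof.
move=> /subsetP sA; apply: connect_sub => u v /= /and3P[uA vA uv].
by apply: connect1; rewrite /= !sA.
Qed.

Lemma separates_sym X c Y Z : separates X c Y Z -> separates X c Z Y.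
Proof.
case=> <- YZ nadj; split; rewrite 1?setUC // 1?setIC // => z y zZ yY zy.
by rewrite orbC nadj // adj_sym.
Qed.

Section Separation.
Variables (X : {set G}) (c : G) (Y Z : {set G}).
Hypothesis sepX : separates X c Y Z.

Lemma separates_l : c \in Y.
Proof.
by case: sepX => _ YZ _; have := set11 c; rewrite -YZ => /setIP[].
Qed.

Lemma separates_r : c \in Z.
Proof.
by case: sepX => _ YZ _; have := set11 c; rewrite -YZ => /setIP[].
Qed.

Lemma separates_sub : Y \subset X.
Proof. by case: sepX => <- _ _; apply: subsetUl. Qed.

Lemma separates_eq y : y \in Y -> y \in Z -> y = c.
Proof.
by case: sepX => _ YZ _ yY yZ; apply/set1P; rewrite -YZ inE yY.
Qed.

Lemma separates_inr x : x \in X -> x \notin Y -> x \in Z.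
Proof. by case: sepX => <- _ _; rewrite inE => /orP[->|]. Qed.

Lemma card_separates : #|X|.+1 = #|Y| + #|Z|.
Proof.
by case: sepX => <- YZ _; rewrite -cardsUI YZ cards1 addn1.
Qed.

Hypothesis gX : geodesic X.

(** Induction on the distance. The predecessor of [z] on a geodesic stays in [Z]: if it lies in [Y],
    its edge to [z] forces it to be [c]. *)
Lemma dist_separates y z :
  y \in Y -> z \in Z -> dist y z = dist y c + dist c z.
Proof.
case: (sepX) => XYZ _ nadj yY.
have [n] := ubnP (dist y z); elim: n z => // n IHn z le_n zZ.
have [->|zc] := eqVneq z c; first by rewrite dist_xx addn0.
have yz : y != z by apply: contraNneq zc => yz; apply/eqP/separates_eq => //; rewrite -yz.
have [yX zX] : y \in X /\ z \in X by rewrite -XYZ !inE yY zZ orbT.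
have [z' z'X [z'z dz']] := gX yX zX yz.
have z'Z : z' \in Z.
  case/boolP: (z' \in Y) => [z'Y|]; last exact: separates_inr.
  have := nadj _ _ z'Y zZ z'z; rewrite (negPf zc) orbF => /eqP->.
  exact: separates_r.
have := IHn z' _ z'Z; rewrite -ltnS dz' => /(_ le_n) eq_yz'.
have := dist_triangle conG y c z; have := dist_triangle conG c z' z.
have := adj_dist z'z; lia.
Qed.

(** A predecessor of [y] outside [Y] would lie in [Z]; its edge forces [y = c], and by
    [dist_separates] it would be farther from [x] than [c] is. *)
Lemma separates_geodesic : geodesic Y.
Proof.
case: (sepX) => XYZ _ nadj x y xY yY xy.
have [xX yX] : x \in X /\ y \in X by rewrite -XYZ !inE yY xY.
have [z zX [zy dz]] := gX xX yX xy; exists z => //.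
apply/negPn/negP => zY; have zZ := separates_inr zX zY.
have zc : z != c by apply: contraNneq zY => ->; apply: separates_l.
have := nadj y z yY zZ; rewrite adj_sym zy (negPf zc) orbF => /(_ isT)/eqP yc.
by have := dist_separates xY zZ; rewrite -yc; lia.
Qed.

(* Collapsing the Z-side onto c sends a walk of X avoiding w to a walk of Y
   avoiding w. *)
Lemma cut_in_separates w : cut_in Y w -> w != c -> cut_in X w.
Proof.
case/andP=> wY /existsP[x /andP[xYw /existsP[y /andP[yYw nxy]]]] wc.
rewrite /cut_in (subsetP separates_sub) //=.
have sYw : Y :\ w \subset X :\ w by apply: setSD; apply: separates_sub.
apply/existsP; exists x; rewrite (subsetP sYw) //=.
apply/existsP; exists y; rewrite (subsetP sYw) //=; apply: contra nxy.
pose pr u := if u \in Y then u else c.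
have cYw : c \in Y :\ w by rewrite !inE eq_sym wc separates_l.
have pr_adj u v : u \in X :\ w -> v \in X :\ w -> adj u v -> joined (Y :\ w) (pr u) (pr v).
  case: (sepX) => _ _ nadj /setD1P[uw uX] /setD1P[vw vX] uv; rewrite /pr.
  case: ifPn => uY; case: ifPn => vY.
  - by apply: connect1; rewrite /= !inE uw vw uY vY.
  - have := nadj _ _ uY (separates_inr vX vY) uv.
    by case/orP=> /eqP E; [rewrite E; apply: connect0 | rewrite E separates_l in vY].
  - have := nadj _ _ vY (separates_inr uX uY); rewrite adj_sym => /(_ uv).
    by case/orP=> /eqP E; [rewrite E; apply: connect0 | rewrite E separates_l in uY].
  - exact: connect0.
have prY u : u \in Y :\ w -> pr u = u by case/setD1P=> _ uY; rewrite /pr uY.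
move=> xy; rewrite -[x]prY // -[y]prY //.
case/connectP: xy => p xp ->; elim: p x xp {xYw} => [|z p IHp] x /=.
  by move=> _; apply: connect0.
by case/andP=> /and3P[xX zX xz] /IHp; apply: connect_trans; apply: pr_adj.
Qed.

End Separation.

Definition component X c a : {set G} := [set y in X :\ c | joined (X :\ c) a y].

Lemma mem_component X c a : a \in X :\ c -> a \in component X c a.
Proof. by move=> aX; rewrite inE aX; apply: connect0. Qed.

Lemma component_separates X c a : c \in X -> 
  separates X c (c |: component X c a) (X :\: component X c a).
Proof.
move=> cX; split.
- apply/setP => x; rewrite !inE.
  by case: eqVneq => [->|]; case: (joined _ _ _) => //=; rewrite ?cX ?andbT ?orbb //; case: (x \in X).
- apply/setP => x; rewrite !inE.
  by case: eqVneq => [->|] //=; case: (joined _ _ _); case: (x \in X).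
move=> y z; rewrite !inE; case: eqVneq => //= yc /andP[yX ay].
case/andP=> nz zX yz; apply/negPn/negP => zc; move: nz; rewrite zc zX /=.
move/negP; apply; apply: connect_trans ay (connect1 _).
by rewrite /= !inE yc zc yX zX.
Qed.

Lemma cut_in_component X c a : cut_in X c ->
  exists2 z, z \in X :\: component X c a & z != c.
Proof.
case/andP=> _ /existsP[x /andP[xX /existsP[y /andP[yX nxy]]]].
have [xA|xA] := boolP (x \in component X c a); last first.
  by exists x; case/setD1P: xX => // xc xX; rewrite inE xA.
exists y; case/setD1P: (yX) => // yc yX'; rewrite inE yX' andbT.
apply: contra nxy; move: xA; rewrite !inE => /andP[_ ax] /andP[_ ay].
by apply: connect_trans ay; rewrite /joined joined_sym.
Qed.

Lemma component_cut X c a : geodesic X -> c \in X -> a \in X :\ c ->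
  ~~ cut_in (c |: component X c a) c.
Proof.
move=> gX cX aX; have sepX := component_separates a cX.
set A := component X c a in sepX *; rewrite /cut_in setU11 /= setU1K; last by rewrite !inE eqxx.
(* Paths from [a] in [X :\ c] visit only the component, by induction on their last vertex. *)
have toA u : u \in A -> joined A a u.
  rewrite inE => /andP[_ /connectP[p]]; elim/last_ind: p u => [|p z IHp] u /=.
    by move=> _ ->; apply: connect0.
  rewrite rcons_path last_rcons => /andP[ap /= /and3P[pX zX pz]] ->.
  apply: connect_trans (IHp _ ap erefl) (connect1 _).
  have ajp : joined (X :\ c) a (last a p) by apply/connectP; exists p.
  have ajz : joined (X :\ c) a z.
    by apply: connect_trans ajp (connect1 _); rewrite /= pz pX zX.
  by rewrite /= pz !inE -!in_setD1 pX zX ajp ajz.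
apply/existsPn => x; rewrite negb_and negb_exists -implybE; apply/implyP => xA.
apply/forallP => y; rewrite negb_and negbK -implybE; apply/implyP => yA.
by apply: (connect_trans _ (toA y yA)); rewrite joined_sym; apply: toA.
Qed.

Lemma card_cuts_separates X c Y Z : separates X c Y Z ->
  cut_in X c -> ~~ cut_in Y c -> #|cuts Y| < #|cuts X|.
Proof.
move=> sepX cX cY; apply: proper_card; apply/properP; split.
  apply/subsetP => w; rewrite !inE => wY; apply: (cut_in_separates sepX wY).
  by apply: contraNneq cY => <-.
by exists c; rewrite inE.
Qed.

(** A shortest path from [u] to [c] continues past [c] into another component of [X :\ c]. *)
Lemma cut_in_extend X c u : geodesic X -> cut_in X c -> u \in X -> u != c ->
  exists z, [/\ z \in X, z != c & dist u z = dist u c + dist c z].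
Proof.
move=> gX cutc uX uc; have cX : c \in X by case/andP: cutc.
have [z zA zc] := cut_in_component u cutc; exists z; split=> //.
  by case/setDP: zA.
apply: (dist_separates (component_separates u cX) gX) => //.
by rewrite in_setU1 mem_component ?orbT // !inE uc.
Qed.

(* Taking the component A of X - c of maximal size among all cut vertices c
   forces every other component at c to be free of cut vertices. *)
Lemma leaf_separation X c0 : geodesic X -> cut_in X c0 ->
  exists c Y Z, [/\ separates X c Y Z, 1 < #|Y| & 1 < #|Z|] /\
    [/\ #|cuts Y| < #|cuts X|, ~~ cut_in Y c & cuts Z \subset [set c]].
Proof.
move=> gX cutc0.
pose P (p : G * G) := cut_in X p.1 && (p.2 \in X :\ p.1).
pose F (p : G * G) := #|component X p.1 p.2|.
have [a0 a0X] : exists a0, a0 \in X :\ c0.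
  by case/andP: cutc0 => _ /existsP[x /andP[xX _]]; exists x.
have P0 : P (c0, a0) by rewrite /P /= cutc0.
case: (arg_maxnP F P0) => -[c a] /andP[/= cutc aX] maxF.
have cX : c \in X by case/andP: cutc.
have sepX := component_separates a cX.
have gY := separates_geodesic sepX gX.
have cutY := component_cut gX cX aX.
exists c, (c |: component X c a), (X :\: component X c a); split; split => //.
- rewrite cardsU1 !inE eqxx /= add1n ltnS; apply/card_gt0P.
  by exists a; apply: mem_component.
- have [z zA zc] := cut_in_component a cutc; apply/card_gt1P; exists z, c.
  by split=> //; apply: (separates_r sepX).
- exact: card_cuts_separates sepX cutc cutY.
apply/subsetP => w; rewrite !inE => cutw; apply: contraT => wc.
have cutXw := cut_in_separates (separates_sym sepX) cutw wc.
have wZ : w \in X :\: component X c a by case/andP: cutw.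
have cXw : c \in X :\ w by rewrite !inE eq_sym wc.
(* The component of [c] in [X :\ w] contains [c] together with the whole maximal component, hence is
   larger than it. *)
have := maxF (w, c); rewrite /P /= cutXw cXw => /(_ isT); rewrite /F /= leqNgt => /negP[].
apply: (@leq_trans #|c |: component X c a|).
  by rewrite cardsU1 !inE eqxx.
have wY : w \notin c |: component X c a.
  by rewrite in_setU1 negb_or wc; case/setDP: wZ.
have sYXw : c |: component X c a \subset X :\ w.
  apply/subsetP => u uY; rewrite in_setD1 (subsetP (separates_sub sepX)) // andbT.
  by apply: contraNneq wY => <-.
apply: subset_leq_card; apply/subsetP => u uY; rewrite inE (subsetP sYXw) //=.
by apply: (sub_joined sYXw); apply: geodesic_joined => //; apply: setU11.
Qed.

End CutVertices.

(** * Transmissions by distance layers, and distance sums across a separation *)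

(** The sum (e - 1) + ... + (e - s): the largest correction that [s] singleton layers cause in the
    transmission bound, reached at distances 1, ..., s. *)
Fixpoint bonus s e := if s is s'.+1 then bonus s' e + (e - s) else 0.

Lemma sum_bonus s e : \sum_(1 <= i < s.+1) (e - i) = bonus s e.
Proof. by elim: s => [|s IHs]; [rewrite big_geq | rewrite big_nat_recr //= IHs]. Qed.

Lemma bonusE s e : s <= e -> 2 * bonus s e + s * s.+1 = 2 * s * e.
Proof. by elim: s => [|s IHs] le_se; first by []; have /= := IHs (ltnW le_se); nia. Qed.

Lemma leq_bonus s1 s2 e : s1 <= s2 -> bonus s1 e <= bonus s2 e.
Proof.
by move=> /subnKC <-; elim: (s2 - s1) => [|k IHk]; rewrite ?addn0 // addnS /=; lia.
Qed.

Lemma bonus_succ s e : s <= e -> bonus s e.+1 = bonus s e + s.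
Proof.
by elim: s => [|s IHs] le_se; rewrite //= IHs; lia.
Qed.

(** The weights decrease with [i], so a pattern gains most with its ones in front. Raising [e] by
    one adds 1 to the weight of each one, as in [bonus_succ]. *)
Lemma bonus_ge (b : nat -> bool) e :
  \sum_(1 <= i < e) b i * (e - i) <= bonus (\sum_(1 <= i < e) b i) e.
Proof.
elim: e => [|[|e] IHe]; try by rewrite !big_geq.
rewrite !(@big_nat_recr _ _ _ e.+1) //=.
set s := \sum_(1 <= i < e.+1) b i in IHe *.
have le_se : s <= e.
  rewrite -[X in _ <= X]subn0 -subSS -[X in _ <= X]muln1 -sum_nat_const_nat.
  by apply: leq_sum => i _; case: (b i).
have -> : \sum_(1 <= i < e.+1) b i * (e.+2 - i) = \sum_(1 <= i < e.+1) b i * (e.+1 - i) + s.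
  rewrite /s -big_split; apply: eq_big_nat => i /andP[_ ie] /=.
  by rewrite -mulnSr; congr (_ * _); lia.
case: (b e.+1); rewrite ?addn1 ?addn0 /= bonus_succ; lia.
Qed.

Section Transmission.
Variable G : sgraph.
Hypothesis conG : connected G.
Implicit Types (x y z u v w c : G) (X Y Z : {set G}).

Definition transmission X v := \sum_(u in X) dist v u.
Definition distance_sum X := \sum_(x in X) transmission X x.

Lemma sum_layers X v e (F : nat -> nat) : (forall u, u \in X -> dist v u <= e) ->
  \sum_(u in X) F (dist v u) =
  \sum_(0 <= i < e.+1) #|[set u in X | dist v u == i]| * F i.
Proof.
move=> le_e.
transitivity (\sum_(u in X) \sum_(0 <= i < e.+1) (dist v u == i) * F i).
  apply: eq_bigr => u uX; rewrite big_mkord (bigD1 (Ordinal (le_e u uX : _ < e.+1))) //= eqxx mul1n.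
  rewrite big1 ?addn0 // => i; rewrite -val_eqE /= eq_sym => /negPf->.
  by rewrite mul0n.
rewrite exchange_big; apply: eq_bigr => i _ /=; rewrite -big_distrl /=; congr (_ * _).
rewrite -sum1_card big_mkcond [RHS]big_mkcond; apply: eq_bigr => u _.
by rewrite !inE; case: (u \in X); case: eqP.
Qed.

(** The witness [s'] is the actual number of singleton layers; being below [e], it keeps the closed
    form [bonusE] applicable. *)
Lemma transmission_bound X v e s : geodesic X -> v \in X ->
  (forall u, u \in X -> dist v u <= e) -> (exists2 u, u \in X & dist v u = e) ->
  0 < e -> #|cuts X :\ v| <= s ->
  exists2 s', s' <= s /\ s' < e &
    transmission X v + e ^ 2 <= e * #|X| + bonus s' e /\ 2 * e <= #|X| + s'.
Proof.
move=> gX vX le_e [u0 u0X du0] e_gt0 le_s.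
pose n i := #|[set u in X | dist v u == i]|.
pose b i := n i == 1.
have n_gt0 i : i <= e -> 0 < n i.
  move=> le_ie; have vu0 := geodesic_joined gX vX u0X.
  have [|z zX dz] := joined_crossing (i := i) (dist_lip conG v) vX vu0.
    by rewrite dist_xx du0.
  by apply/card_gt0P; exists z; rewrite inE zX dz eqxx.
pose s' := \sum_(1 <= i < e) b i.
have le_s'e : s' < e.
  rewrite -[X in _ < X]prednK // ltnS -subn1 -[X in _ <= X]muln1 -sum_nat_const_nat.
  by apply: leq_sum => i _; case: (b i).
have b_cut i : 0 < i < e -> b i <= #|[set w in cuts X :\ v | dist v w == i]|.
  case/andP=> i_gt0 lt_ie; case bi: (b i) => //; apply/card_gt0P.
  have [w def_w] := cards1P bi.
  have : w \in [set u in X | dist v u == i] by rewrite def_w set11.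
  rewrite inE => /andP[wX /eqP dw]; exists w; rewrite !inE dw eqxx andbT.
  have vw : v != w by apply: contraTneq i_gt0 => vw; rewrite -dw vw dist_xx.
  rewrite eq_sym vw (single_layer_cut conG vX wX u0X vw) ?dw ?du0 // => x xX dx.
  by apply/set1P; rewrite -def_w inE xX dx eqxx.
have le_s's : s' <= s.
  apply: leq_trans le_s; rewrite -sum1_card.
  have leC u : u \in cuts X :\ v -> dist v u <= e.
    by rewrite !inE => /andP[_ /andP[uX _]]; apply: le_e.
  rewrite (sum_layers (fun => 1) leC) (@big_cat_nat _ _ _ 1) //=.
  apply: leq_trans (leq_addl _ _); rewrite big_nat_recr //=.
  apply: leq_trans (leq_addr _ _); rewrite /s' !big_nat.
  by apply: leq_sum => i ie; rewrite muln1 b_cut.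
exists s' => //.
have n0 : 0 < n 0 by apply: n_gt0.
have ne : 0 < n e by apply: n_gt0.
have layers (F : nat -> nat) :
    \sum_(u in X) F (dist v u) = n 0 * F 0 + \sum_(1 <= i < e) n i * F i + n e * F e.
  rewrite (sum_layers F le_e) big_nat_recr //= (@big_cat_nat _ _ _ 1) //=.
  by rewrite big_nat1.
have nb_ge2 i : 0 < i < e -> 2 <= n i + b i.
  by case/andP=> _ /ltnW/n_gt0; rewrite /b; case: (n i) => [|[|]].
split.
(* The deficit e |X| - t is the sum of e - dist over [X]: layer 0 gives at least e, and each layer i
   strictly inside at least (2 - b i)(e - i). *)
- have eq1 : transmission X v + \sum_(u in X) (e - dist v u) = e * #|X|.
    rewrite mulnC -sum_nat_const -big_split; apply: eq_bigr => u uX /=.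
    by rewrite subnKC ?le_e.
  have le_b := bonus_ge b e; rewrite -/s' in le_b.
  have : \sum_(1 <= i < e) 2 * (e - i) <=
         \sum_(1 <= i < e) n i * (e - i) + \sum_(1 <= i < e) b i * (e - i).
    rewrite -big_split !big_nat; apply: leq_sum => i ie.
    by rewrite /= -mulnDl leq_mul2r nb_ge2 ?orbT.
  have -> : \sum_(1 <= i < e) 2 * (e - i) = e * e.-1.
    by rewrite -big_distrr /= -{1}(prednK e_gt0) sum_bonus; have := bonusE (leq_pred e); nia.
  have := layers (fun i => e - i); rewrite subnn muln0 addn0 subn0 => eq2.
  rewrite eq2 in eq1; move: eq1 le_b; rewrite -mulnn.
  set T1 := (\sum_(1 <= i < e) n i * (e - i)); set T2 := (\sum_(1 <= i < e) b i * (e - i)).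
  by case: (e) e_gt0 => // e' _ /=; nia.
have := layers (fun => 1); rewrite sum_nat_const !muln1 => ->.
have : \sum_(1 <= i < e) 2 <= \sum_(1 <= i < e) n i * 1 + s'.
  rewrite /s' -big_split !big_nat; apply: leq_sum => i ie.
  by rewrite /= muln1 nb_ge2.
rewrite sum_nat_const_nat; lia.
Qed.

Lemma sum_separates (F : G -> nat) X c Y Z : separates X c Y Z ->
  \sum_(x in X) F x = \sum_(x in Y) F x + \sum_(x in Z :\ c) F x.
Proof.
move=> sepX; have cY := separates_l sepX.
have dYZ : [disjoint Y & Z :\ c].
  apply/pred0P => x /=; apply/negP => /andP[xY /setD1P[xc xZ]].
  by rewrite (separates_eq sepX xY xZ) eqxx in xc.
have -> : X = Y :|: Z :\ c.
  case: (sepX) => <- _ _; apply/setP => x; rewrite !inE.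
  by case: eqVneq => [->|] //=; rewrite cY.
by rewrite -bigU //; apply: eq_bigl => x; rewrite !inE.
Qed.

Lemma transmission_separates X c Y Z : separates X c Y Z ->
  transmission X c = transmission Y c + transmission Z c.
Proof.
move=> sepX; rewrite /transmission (sum_separates _ sepX) [in RHS](big_setD1 _ (separates_r sepX)).
by rewrite dist_xx.
Qed.

(** Cross distances run through [c]. Their sum over [Y] and [Z :\ c] has |Y| copies of
    [transmission Z c]; the copy for [y = c] already belongs to [distance_sum Z], which leaves |Y| -
    1. *)
Lemma total_separates X c Y Z : geodesic X -> separates X c Y Z ->
  distance_sum X = distance_sum Y + distance_sum Z +
    2 * (#|Z|.-1 * transmission Y c + #|Y|.-1 * transmission Z c).
Proof.
move=> gX sepX; have cY := separates_l sepX; have cZ := separates_r sepX.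
have sumX (F : G -> nat) := sum_separates F sepX.
have sumZ (F : G -> nat) : \sum_(x in Z) F x = F c + \sum_(x in Z :\ c) F x.
  by rewrite (big_setD1 c).
have tZ : transmission Z c = \sum_(z in Z :\ c) dist c z.
  by rewrite /transmission sumZ dist_xx.
have cardZ : #|Z| = #|Z :\ c|.+1 by rewrite (cardsD1 c) cZ.
have cross : \sum_(y in Y) \sum_(z in Z :\ c) dist y z =
    #|Z|.-1 * transmission Y c + #|Y| * transmission Z c.
  rewrite (eq_bigr (fun y => #|Z|.-1 * dist c y + transmission Z c)) => [|y yY].
    by rewrite big_split sum_nat_const -big_distrr.
  rewrite tZ (dist_sym c y) cardZ /= -sum_nat_const -big_split /=.
  apply: eq_bigr => z /setD1P[_ zZ]; exact: (dist_separates conG sepX gX).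
have cardY : #|Y| = #|Y|.-1.+1 by rewrite prednK //; apply/card_gt0P; exists c.
have cross' : \sum_(z in Z :\ c) \sum_(y in Y) dist z y = \sum_(y in Y) \sum_(z in Z :\ c) dist y z.
  by rewrite exchange_big; apply: eq_bigr => y _; apply: eq_bigr => z _; apply: dist_sym.
rewrite /distance_sum sumX /transmission.
rewrite (eq_bigr (fun y => transmission Y y + \sum_(z in Z :\ c) dist y z)) => [|y _]; last exact: sumX.
rewrite [X in _ + X = _](eq_bigr
  (fun z => \sum_(y in Y) dist z y + \sum_(u in Z :\ c) dist z u)) => [|z _]; last exact: sumX.
rewrite !big_split /= cross' cross.
have -> : \sum_(x in Z) \sum_(u in Z) dist x u =
   transmission Z c + (transmission Z c + \sum_(z in Z :\ c) \sum_(u in Z :\ c) dist z u).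
  rewrite sumZ; congr (_ + _).
  rewrite (eq_bigr (fun z => dist z c + \sum_(u in Z :\ c) dist z u)) => [|z _]; last exact: sumZ.
  rewrite big_split tZ; congr (_ + _); apply: eq_bigr => z _; exact: dist_sym.
rewrite /transmission cardY /=; nia.
Qed.

End Transmission.

(** * Numerical estimates for gluing two sides at a vertex *)

(* Upper bounds for how much the bound obtained from the recursion over leaf
   separations exceeds m floor(m^2/4); the values were found numerically. *)
Definition excess k m :=
  if k is k'.+1 then
    if k' is 0 then if m <= 5 then 2 else 0
    else if m <= 5 then 6 else if m <= 7 then 4 else if m == 9 then 2 else 0
  else 0.

Definition total_max k m := m * (m ^ 2 %/ 4) + excess k m.

Definition transmission_max k m := ((m + k) ^ 2 - 2 * k * k.+1) %/ 4.

Lemma quarter_le m : 4 * (m %/ 4) <= m.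
Proof. by rewrite mulnC leq_divM. Qed.

(** Together with [cube_total_max] this trades the floor for cubic polynomials; 8 and 24 are four
    times the largest values 2 and 6 of [excess]. *)
Lemma total_max_cube k m : k <= 2 ->
  4 * total_max k m <= m ^ 3 + (if k is k'.+1 then if k' is 0 then 8 else 24 else 0).
Proof.
rewrite /total_max /excess => k2; have := quarter_le (m ^ 2); move: (m ^ 2 %/ 4) => t.
by case: k k2 => [|[|k]] _; repeat case: ifP => _; nia.
Qed.

Lemma cube_total_max k m : m ^ 3 <= 4 * total_max k m + m.
Proof.
rewrite /total_max mulnDr; apply: leq_trans (leq_add (leq_addr _ _) (leqnn m)).
have : m ^ 2 <= 4 * (m ^ 2 %/ 4) + 1.
  rewrite {1 2}(divn_eq m 2) modn2; set q := m %/ 2; case: (odd m) => /=.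
    have -> : (q * 2 + 1) ^ 2 = 4 * (q ^ 2 + q) + 1 by nia.
    by rewrite (mulnC 4) divnMDl // addn0 mulnC.
  have -> : (q * 2 + 0) ^ 2 = q ^ 2 * 4 by nia.
  by rewrite mulnK // mulnC leq_addr.
by move: (m ^ 2 %/ 4) => t; nia.
Qed.

Lemma cube_step k a b W1 W2 t1 t2 : k <= 2 -> 0 < a -> 0 < b ->
  (if k is k'.+1 then if k' is 0 then 11 else 16 else 8) <= a + b ->
  W1 <= total_max k a.+1 -> 4 * W2 <= b.+1 ^ 3 + 8 ->
  4 * t1 + 2 * k * k.+1 <= (a.+1 + k) ^ 2 -> 4 * t2 <= b.+1 ^ 2 ->
  4 * (W1 + W2 + 2 * (b * t1 + a * t2)) + (a + b).+1 <= (a + b).+1 ^ 3.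
Proof.
move=> k2 a0 b0 ab W1le W2le t1le t2le.
have {}W1le := leq_trans (leq_mul (leqnn 4) W1le) (total_max_cube a.+1 k2).
have bt1 : 4 * (b * t1) + b * (2 * k * k.+1) <= b * (a.+1 + k) ^ 2.
  by apply: leq_trans (leq_mul (leqnn b) t1le); rewrite mulnDr mulnCA.
have at2 : 4 * (a * t2) <= a * b.+1 ^ 2.
  by rewrite mulnCA leq_mul2l t2le orbT.
have ab_ge : a + b <= a * b + 1.
  by case: a b a0 b0 {ab W1le W2le t1le t2le bt1 at2} => [|a] [|b] // _ _; lia.
(* The two sides differ by a b r up to terms linear in a and b. Since a b >= a + b - 1 = 1 + 4 k +
   r, this is at least (1 + 4 k + r) r, which prevails from the assumed thresholds on. *)
have [r rE] : exists r, a + b = 2 + 4 * k + r.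
  by exists (a + b - (2 + 4 * k)); rewrite subnKC //; case: k k2 ab {W1le t1le bt1} => [|[|[|]]]; lia.
have abr : (1 + 4 * k + r) * r <= a * b * r by rewrite leq_mul2r; lia.
have abs : a * b * (a + b) = a * b * (2 + 4 * k + r) by rewrite rE.
move: (a * t2) (b * t1) bt1 at2 => U V.
move: k2 ab W1le rE abr abs {t1le}; case: k => [|[|[|]]] //= _ ab W1le rE abr abs.
- have rr : 6 * r <= r * r by rewrite leq_mul2r; lia.
  by lia.
- have rr : 5 * r <= r * r by rewrite leq_mul2r; lia.
  by lia.
- have rr : 6 * r <= r * r by rewrite leq_mul2r; lia.
  by lia.
Qed.

(* The constraints that the layers impose on the transmission t of a vertex of
   eccentricity e in a set of m vertices: at most k cut vertices elsewhere for
   layered, and the vertex being the only cut vertex for starred. *)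
Definition layered k m e t :=
  exists2 s, s <= k /\ s < e & t + e ^ 2 <= e * m + bonus s e /\ 2 * e <= m + s.

Definition starred m e t := [/\ 0 < e, t + e ^ 2 + e.-1 <= e * m & 2 * e < m].

(** As 2 bonus = 2 s e - s (s + 1), the layer bound reads 4 t + 2 s (s + 1) <= 4 e (m + s) - 4 e^2,
    which is at most (m + s)^2 by completing the square. *)
Lemma layered_quarter k m e t : k <= 2 -> 1 < m -> layered k m e t ->
  4 * t + 2 * k * k.+1 <= (m + k) ^ 2.
Proof.
move=> k2 m1 [s [sk se] [te _]]; have bE := bonusE (ltnW se).
have ts : 4 * t + 2 * s * s.+1 <= (m + s) ^ 2.
  have : 2 * (2 * e * (m + s)) <= (2 * e) ^ 2 + (m + s) ^ 2.
    exact: (nat_Cauchy (2 * e) (m + s)).1.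
  by lia.
(* Passing from [s] to [k] weakens the bound when m >= 3. At m = 2, s = 1, k = 2 integrality is
   needed: both bounds then say t <= 1. *)
case: m m1 ts {te bE} => [|[|[|m]]] // _;
  by case: k s k2 sk {se} => [|[|[|]]] // [|[|[|]]] //= _ _; lia.
Qed.

Lemma starred_quarter m e t : starred m e t -> 4 * t <= m.-1 ^ 2 + 4.
Proof.
case: m => [|m] [e0 te em] //=.
have := (nat_Cauchy (2 * e) m).1; lia.
Qed.

(** The two forms of the side [Z]: without cut vertices, or with the gluing vertex as its only
    one. *)
Definition leaf_side m e W t :=
  W <= total_max 0 m /\ layered 0 m e t \/ W <= total_max 1 m /\ starred m e t.

Lemma leaf_side_quarter m e W t : 1 < m -> leaf_side m e W t ->
  4 * W <= m ^ 3 + 8 /\ 4 * t <= m ^ 2.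
Proof.
move=> m1 [[WZ /(@layered_quarter 0 m e t isT m1) tZ]|[WZ st]].
  have := @total_max_cube 0 m isT; rewrite addn0 in tZ; lia.
have := @total_max_cube 1 m isT; have := starred_quarter st.
case: st => e0 _ em; split; first by lia.
by case: m m1 em {WZ} H H0 => // m m1 em; nia.
Qed.

(** The inequality of [total_step] with every quantity at its bound, ready for evaluation. The guard
    [b < 2] reflects that a starred side has at least three vertices. *)
Definition quarter_step k a b :=
  let Wt W t := W + 2 * a * t in
  total_max k a.+1 + 2 * b * transmission_max k a.+1 +
    maxn (Wt (total_max 0 b.+1) (transmission_max 0 b.+1))
         (if b < 2 then 0 else Wt (total_max 1 b.+1) (b ^ 2 %/ 4).+1)
  <= total_max k.+1 (a + b).+1.

Lemma quarter_step_small :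
  all (fun k => all (fun a => all (quarter_step k a) (iota 1 10)) (iota 1 10)) (iota 0 2).
Proof. by vm_compute. Qed.

Lemma total_step k a b e f W1 W2 t1 t2 : k <= 1 -> 0 < a -> 0 < b ->
  W1 <= total_max k a.+1 -> layered k a.+1 e t1 -> leaf_side b.+1 f W2 t2 ->
  W1 + W2 + 2 * (b * t1 + a * t2) <= total_max k.+1 (a + b).+1.
Proof.
move=> k1 a0 b0 W1le t1le side.
have {}t1le := layered_quarter (leqW k1) (a0 : 1 < a.+1) t1le.
(* 11 is the threshold of [cube_step] for k = 1 and exceeds that for k = 0; below it [a] and [b] lie
   in the range of [quarter_step_small]. *)
have [large|small] := leqP 11 (a + b).
  have [W2le t2le] := leaf_side_quarter (b0 : 1 < b.+1) side.
  have large' : (if k is k'.+1 then if k' is 0 then 11 else 16 else 8) <= a + b.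
    by case: k k1 {W1le t1le} => [|[|]] // _; lia.
  have := cube_step (leqW k1) a0 b0 large' W1le W2le t1le t2le.
  have := cube_total_max k.+1 (a + b).+1; lia.
have t1max : t1 <= transmission_max k a.+1.
  by rewrite leq_divRL //; lia.
have /allP/(_ k) := quarter_step_small; rewrite mem_iota => /(_ k1)/allP/(_ a).
rewrite mem_iota a0 => /(_ _)/allP; rewrite [_ < _]/=.
have -> : a < 1 + 10 by lia.
move=> /(_ isT b); rewrite mem_iota b0.
have -> : b < 1 + 10 by lia.
move=> /(_ isT); apply: leq_trans; rewrite mulnDr !mulnA addnACA leq_add //.
  by rewrite leq_add // leq_mul2l t1max orbT.
have le0 : b.+1.-1 = b by [].
rewrite leq_max; case: side => [[W2le t2le]|[W2le st]]; apply/orP; [left|right].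
  rewrite leq_add // leq_mul2l leq_divRL // mulnC.
  have := @layered_quarter 0 _ _ _ isT (b0 : 1 < b.+1) t2le; lia.
have -> : (b < 2) = false by case: st => *; lia.
rewrite leq_add // leq_mul2l -ltnS -(addn1 t2) -addn1; apply/orP; right.
have := starred_quarter st => /= t2le.
suff : t2.-1 <= b ^ 2 %/ 4 by lia.
by rewrite leq_divRL //; lia.
Qed.

(** The layer bound solved for [t], with the largest [s] that [s <= k] and [s < e] permit. *)
Definition layered_max k m e := e * m + bonus (minn k e.-1) e - e ^ 2.

Lemma layered_le k m e t : layered k m e t ->
  0 < e /\ t <= layered_max k m e /\ 2 * e <= m + minn k e.-1.
Proof.
case=> s [sk se] [te em].
have le_s : s <= minn k e.-1 by rewrite leq_min sk; lia.
by have := leq_bonus e le_s; rewrite /layered_max; lia.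
Qed.

(** Unlike [quarter_step], this keeps the eccentricities instead of optimising over them, so that e
    + f <= d can be imposed. *)
Definition diameter_step k d a e f :=
  let b := 2 * d - a in
  let Wt W t := W + 2 * a * t in
  (2 * e <= a.+1 + minn k e.-1) && (e + f <= d) ==>
  (total_max k a.+1 + 2 * b * layered_max k a.+1 e +
    maxn (if 2 * f <= b.+1 then Wt (total_max 0 b.+1) (layered_max 0 b.+1 f) else 0)
         (if 2 * f < b.+1 then Wt (total_max 1 b.+1) (f * b.+1 - f ^ 2 - f.-1) else 0)
  <= (2 * d).+1 * (d * d.+1)).

Definition diameter_steps k d :=
  all (fun a => all (fun e => all (diameter_step k d a e) (iota 1 d)) (iota 1 d))
      (iota 1 (2 * d).-1).

Lemma diameter_steps_small :
  diameter_steps 1 3 && all (diameter_steps 2) (iota 4 4).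
Proof. by vm_compute. Qed.

Lemma diameter_total_step k d a b e f W1 W2 t1 t2 :
  (k == 1) && (d == 3) || (k == 2) && (3 < d) ->
  a + b = 2 * d -> e + f <= d -> 0 < a -> 0 < b ->
  W1 <= total_max k a.+1 -> layered k a.+1 e t1 -> leaf_side b.+1 f W2 t2 ->
  W1 + W2 + 2 * (b * t1 + a * t2) <= (2 * d).+1 * (d * d.+1).
Proof.
move=> kd abd efd a0 b0 W1le t1le side.
(* d >= 8 is the threshold 16 of [cube_step] for k = 2, whose conclusion suffices because (2 d +
   1)^3 - (2 d + 1) = 4 (2 d + 1) d (d + 1). *)
have [large|small] := leqP 8 d.
  have {}kd : k = 2 by lia.
  rewrite {k}kd in W1le t1le; have {}t1le := @layered_quarter 2 _ _ _ isT (a0 : 1 < a.+1) t1le.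
  have [W2le t2le] := leaf_side_quarter (b0 : 1 < b.+1) side.
  have large' : 16 <= a + b by rewrite abd; lia.
  have := @cube_step 2 a b _ _ _ _ isT a0 b0 large' W1le W2le t1le t2le.
  rewrite abd; lia.
have steps : diameter_steps k d.
  case/andP: diameter_steps_small => ok3 /allP ok.
  case/orP: kd => /andP[/eqP-> d3]; first by rewrite (eqP d3).
  by apply: ok; rewrite mem_iota; lia.
have [e0 [t1max em]] := layered_le t1le.
have f0 : 0 < f by case: side => [[_ /layered_le[]]|[_ []]].
move/allP/(_ a): steps; rewrite mem_iota => /(_ ltac:(lia))/allP/(_ e).
rewrite mem_iota => /(_ ltac:(lia))/allP/(_ f).
rewrite mem_iota => /(_ ltac:(lia)); rewrite /diameter_step em efd /=.
have -> : 2 * d - a = b by lia.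
apply: leq_trans; rewrite mulnDr !mulnA addnACA leq_add //.
  by rewrite leq_add // leq_mul2l t1max orbT.
rewrite leq_max; case: side => [[W2le t2le]|[W2le [_ t2le fb]]]; apply/orP; [left|right].
  have [_ [t2max]] := layered_le t2le; rewrite min0n addn0 => ->.
  by rewrite leq_add // leq_mul2l t2max orbT.
rewrite fb leq_add // leq_mul2l; apply/orP; right.
by rewrite (mulnC f) in t2le *; lia.
Qed.

Lemma leq_layered k1 k2 m e t : k1 <= k2 -> layered k1 m e t -> layered k2 m e t.
Proof. by move=> k12 [s [sk se] te]; exists s => //; split=> //; apply: leq_trans k12. Qed.

Lemma layered0 m e t : layered 0 m e t -> t + e ^ 2 <= e * m /\ 2 * e <= m.
Proof. by case=> s [s0 _]; move: s0; rewrite leqn0 => /eqP-> /=; rewrite !addn0. Qed.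

(** With e = f + e' and m2 = m' + 2, the transmission bound reduces to (f - 1)^2 + e' m' >= 0. *)
Lemma glued_starred m m1 m2 e f t1 t2 : m.+1 = m1 + m2 -> 0 < f -> f <= e ->
  t2 + f ^ 2 <= f * m2 -> 2 * f <= m2 -> t1 + e ^ 2 <= e * m1 -> 2 * e <= m1 ->
  starred m e (t1 + t2).
Proof.
move=> mE f0 fe t2f f2 t1e e1; split; [lia | | lia].
have -> : m = m1 + m2.-1 by lia.
have [e' eE] : exists e', e = f + e' by exists (e - f); lia.
have [m' m'E] : exists m', m2 = m'.+2 by exists m2.-2; lia.
subst e m2; rewrite /=; have := (nat_Cauchy f 1).1; have := leq0n (e' * m'); lia.
Qed.

(** * Induction over leaf separations *)

Section WienerBound.
Variable G : sgraph.
Hypothesis conG : connected G.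
Implicit Types (x y z u v w c : G) (X Y Z : {set G}).

Definition eccentricity X v := \max_(u in X) dist v u.

Lemma le_eccentricity X v u : u \in X -> dist v u <= eccentricity X v.
Proof. by move=> uX; apply: (@leq_bigmax_cond _ (mem X) (dist v)). Qed.

Lemma eccentricity_dist X v : v \in X -> exists2 u, u \in X & dist v u = eccentricity X v.
Proof.
move=> vX; have X0 : 0 < #|X| by apply/card_gt0P; exists v.
by have [u uX def_e] := eq_bigmax_cond (dist v) X0; exists u.
Qed.

Lemma eccentricity_gt0 X v : 1 < #|X| -> 0 < eccentricity X v.
Proof.
case/card_gt1P=> x [y [xX yX xy]]; have [xv|xv] := eqVneq v x.
  apply: leq_trans (le_eccentricity v yX); rewrite lt0n dist_eq0 //.
  by rewrite xv.
by apply: leq_trans (le_eccentricity v xX); rewrite lt0n dist_eq0.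
Qed.

Lemma transmission_layered X v k : geodesic X -> v \in X -> 1 < #|X| ->
  #|cuts X :\ v| <= k -> layered k #|X| (eccentricity X v) (transmission X v).
Proof.
move=> gX vX X1; apply: transmission_bound => //; last exact: eccentricity_gt0.
- by move=> u; apply: le_eccentricity.
- exact: eccentricity_dist.
Qed.

(** Cutting off the component of a vertex farthest from [c] gives one side with the full
    eccentricity. Neither side has a cut vertex besides [c], so [layered0] applies to both and
    [glued_starred] combines them. *)
Lemma transmission_starred X c : geodesic X -> cut_in X c -> cuts X \subset [set c] ->
  starred #|X| (eccentricity X c) (transmission X c).
Proof.
move=> gX cutc /subsetP onlyc; have cX : c \in X by case/andP: cutc.
have [z0 _ z0c] := cut_in_component c cutc.
have [u uX du] := eccentricity_dist cX.
have X1 : 1 < #|X|.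
  have [z zA zc] := cut_in_component c cutc; apply/card_gt1P.
  by exists z, c; split=> //; case/setDP: zA.
have e0 := eccentricity_gt0 c X1.
have uc : u != c by apply: contraTneq e0 => uc; rewrite -du uc dist_xx.
have sepX := component_separates u cX.
have uY : u \in c |: component X c u by rewrite in_setU1 mem_component ?orbT // !inE uc.
have [z zZ zc] := cut_in_component u cutc.
have nocut Y Z : separates X c Y Z -> #|cuts Y :\ c| <= 0.
  move=> sep; rewrite leqn0 cards_eq0; apply/eqP/setP => w; rewrite !inE.
  apply/negP => /andP[wc /(cut_in_separates sep)/(_ wc) cutw].
  by have := onlyc w; rewrite !inE (negPf wc) => /(_ cutw).
set Y := c |: component X c u in sepX uY; set Z := X :\: _ in sepX zZ.
have sepX' := separates_sym sepX.
have cY := separates_l sepX; have cZ := separates_r sepX.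
have Y1 : 1 < #|Y| by apply/card_gt1P; exists u, c.
have Z1 : 1 < #|Z| by apply/card_gt1P; exists z, c.
have := layered0 (transmission_layered (separates_geodesic conG sepX gX) cY Y1 (nocut _ _ sepX)).
have := layered0 (transmission_layered (separates_geodesic conG sepX' gX) cZ Z1 (nocut _ _ sepX')).
have -> : eccentricity Y c = eccentricity X c.
  apply/eqP; rewrite eqn_leq -{2}du le_eccentricity // andbT.
  by apply/bigmax_leqP => y yY; apply/le_eccentricity/(subsetP (separates_sub sepX)).
have : eccentricity Z c <= eccentricity X c.
  by apply/bigmax_leqP => y yZ; apply/le_eccentricity/(subsetP (separates_sub sepX')).
have := eccentricity_gt0 c Z1; have := card_separates sepX.
rewrite (transmission_separates sepX).
by move=> cardX f0 fe [tZ eZ] [tY eY]; apply: (glued_starred cardX f0 fe).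
Qed.

(** The numerical content of a leaf separation, [e] and [f] being the eccentricities of the cutting
    vertex in the two sides. The last clause is how the diameter limits e + f. *)
Lemma leaf_split X c0 : geodesic X -> cut_in X c0 ->
  exists Y Z a b, exists e f t1 t2,
  [/\ [/\ geodesic Y, geodesic Z, #|Y| = a.+1, #|Z| = b.+1 & #|X| = (a + b).+1],
      [/\ 0 < a, 0 < b, #|cuts Y| < #|cuts X| &
          distance_sum X = distance_sum Y + distance_sum Z +
    2 * (b * t1 + a * t2)],
      layered #|cuts Y| a.+1 e t1,
      (cuts Z = set0 /\ layered 0 b.+1 f t2) \/ (#|cuts Z| <= 1 /\ starred b.+1 f t2)
    & exists x y, [/\ x \in X, y \in X & dist x y = e + f]].
Proof.
move=> gX cutc0.
have [c [Y [Z [[sepX Y1 Z1] [cutsY ncutY cutsZ]]]]] := leaf_separation conG gX cutc0.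
have sepX' := separates_sym sepX.
have gY := separates_geodesic conG sepX gX; have gZ := separates_geodesic conG sepX' gX.
have cY := separates_l sepX; have cZ := separates_r sepX.
have aE : #|Y| = #|Y|.-1.+1 by rewrite prednK // ltnW.
have bE : #|Z| = #|Z|.-1.+1 by rewrite prednK // ltnW.
exists Y, Z, #|Y|.-1, #|Z|.-1.
exists (eccentricity Y c), (eccentricity Z c), (transmission Y c), (transmission Z c).
split; first by split=> //; have := card_separates sepX; lia.
- by split=> //; first [lia | exact: total_separates].
- by rewrite -aE; apply: transmission_layered => //; apply: subset_leq_card (subsetDl _ _).
- rewrite -bE; have [cutc|ncutc] := boolP (cut_in Z c); [right|left].
    split; last exact: transmission_starred.
    by rewrite -(cards1 c) subset_leq_card.
  have cutsZ0 : cuts Z = set0.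
    apply/setP => w; rewrite !inE; apply: contraNF ncutc => cutw.
    by have := subsetP cutsZ w; rewrite !inE => /(_ cutw)/eqP<-.
  by split=> //; apply: transmission_layered; rewrite // cutsZ0 set0D cards0.
have [y yY <-] := eccentricity_dist cY; have [z zZ <-] := eccentricity_dist cZ.
exists y, z; rewrite (dist_sym c y) (dist_separates conG sepX gX yY zZ).
by split=> //; [apply: subsetP (separates_sub sepX) _ yY | apply: subsetP (separates_sub sepX') _ zZ].
Qed.

Lemma total_block X : geodesic X -> cuts X = set0 -> distance_sum X <= total_max 0 #|X|.
Proof.
move=> gX cutsX; have [X1|] := leqP #|X| 1.
  suff -> : distance_sum X = 0 by [].
  rewrite /distance_sum big1 // => x xX; rewrite /transmission big1 // => y yX.
  by have /card_le1P/(_ x xX y) := X1; rewrite yX inE => /esym/eqP->; apply: dist_xx.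
move=> X1; rewrite /total_max addn0 -sum_nat_const; apply: leq_sum => v vX.
have := @layered_quarter 0 _ _ _ isT X1 (transmission_layered (k := 0) gX vX X1 _).
by rewrite cutsX set0D cards0 addn0 leq_divRL // => /(_ isT); lia.
Qed.

Lemma total_le_max X k : geodesic X -> k <= 2 -> #|cuts X| <= k ->
  distance_sum X <= total_max k #|X|.
Proof.
(* The induction is on the size of [X], since the leaf side may have as many cut vertices as [X]. *)
have [n] := ubnP #|X|; elim: n X k => // n IHn X k ltn gX k2 le_k.
have [cutsX|[c0]] := set_0Vmem (cuts X).
  by apply: leq_trans (total_block gX cutsX) _; rewrite /total_max leq_add2l.
rewrite inE => cutc0.
have [Y [Z [a [b [e [f [t1 [t2 [[gY gZ Ya Zb Xab] [a0 b0 cutsY ->] tY tZ _]]]]]]]]] :=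
  leaf_split gX cutc0.
case: k le_k k2 => [|k] le_k k2; first by lia.
have le_kY : #|cuts Y| <= k by lia.
rewrite Xab; apply: (@total_step k a b e f) => //.
- by rewrite -Ya; apply: IHn => //; lia.
- exact: leq_layered tY.
case: tZ => [[cutsZ tZ]|[cutsZ tZ]]; [left|right]; split=> //.
  by rewrite -Zb total_block.
by rewrite -Zb; apply: IHn => //; lia.
Qed.

Lemma total_le_diameter X d : geodesic X -> #|X| = (2 * d).+1 -> 3 <= d ->
  (forall x y, x \in X -> y \in X -> dist x y <= d) ->
  #|cuts X| <= (if d == 3 then 2 else 3) ->
  distance_sum X <= (2 * d).+1 * (d * d.+1).
Proof.
move=> gX Xd d3 diam le_k.
have [cutsX|[c0]] := set_0Vmem (cuts X).
  apply: leq_trans (total_block gX cutsX) _.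
  have := cube_total_max 0 #|X|; rewrite /total_max addn0 Xd leq_mul2l /= => _.
  have := quarter_le ((2 * d).+1 ^ 2); nia.
rewrite inE => cutc0.
have [Y [Z [a [b [e [f [t1 [t2 [[gY gZ Ya Zb Xab] [a0 b0 cutsY ->] tY tZ]]]]]]]]] :=
  leaf_split gX cutc0.
case=> x [y [xX yX dxy]].
pose k := if d == 3 then 1 else 2.
have k2 : k <= 2 by rewrite /k; case: ifP.
have le_kY : #|cuts Y| <= k by move: le_k; rewrite /k; case: ifP => _; lia.
apply: (@diameter_total_step k d a b e f) => //.
- by rewrite /k; case: (d =P 3) => [->|] //; lia.
- by lia.
- by rewrite -dxy diam.
- by rewrite -Ya; apply: total_le_max.
- exact: leq_layered tY.
case: tZ => [[cutsZ tZ]|[cutsZ tZ]]; [left|right]; split=> //.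
  by rewrite -Zb total_block.
by rewrite -Zb; apply: total_le_max.
Qed.

End WienerBound.

(** * Three cut vertices in diameter three *)

Section SevenVertices.
Variable G : sgraph.
Hypothesis conG : connected G.
Implicit Types (x y z u v w c : G) (X Y Z : {set G}).

(** A shortest path between two cut vertices extends by at least one step beyond each end. *)
Lemma dist_cuts X d c c' : geodesic X -> (forall x y, x \in X -> y \in X -> dist x y <= d) ->
  cut_in X c -> cut_in X c' -> c != c' -> dist c c' + 2 <= d.
Proof.
move=> gX diam cutc cutc' cc'.
have [cX c'X] : c \in X /\ c' \in X by case/andP: cutc => ->; case/andP: cutc' => ->.
have [z [zX zc dz]] : exists z, [/\ z \in X, z != c & dist c' z = dist c' c + dist c z].
  by apply: cut_in_extend; rewrite // eq_sym.
have sepX := component_separates c c'X.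
have [z' z'Z z'c'] := cut_in_component c cutc'.
have cY : c \in c' |: component X c' c by rewrite in_setU1 mem_component ?orbT // !inE cc'.
have cz : 0 < dist c z by rewrite lt0n dist_eq0 // eq_sym.
have cc'0 : 0 < dist c' c by rewrite lt0n dist_eq0 // eq_sym.
have zY : z \in c' |: component X c' c.
  apply: contraT => /(separates_inr sepX zX) zZ.
  by have := dist_separates conG sepX gX cY zZ; rewrite (dist_sym c c'); move: dz cc'0; clear; lia.
have := dist_separates conG sepX gX zY z'Z.
have c'z' : 0 < dist c' z' by rewrite lt0n dist_eq0 // eq_sym.
have z'X : z' \in X by case/setDP: z'Z.
have := diam z z' zX z'X; rewrite (dist_sym z c') (dist_sym c c'); move: dz cz c'z'; clear; lia.
Qed.

Lemma dist_cut X d c u : geodesic X -> (forall x y, x \in X -> y \in X -> dist x y <= d) ->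
  cut_in X c -> u \in X -> u != c -> dist u c < d.
Proof.
move=> gX diam cutc uX uc.
have [z [zX zc dz]] := cut_in_extend conG gX cutc uX uc.
have : 0 < dist c z by rewrite lt0n dist_eq0 // eq_sym.
by have := diam u z uX zX; move: dz; clear; lia.
Qed.

(* Each of the three cut vertices has transmission at most 9 and every other
   vertex at most 14, and 3 * 9 + 4 * 14 = 83. *)
Lemma distance_sum_seven X : geodesic X -> #|X| = 7 ->
  (forall x y, x \in X -> y \in X -> dist x y <= 3) -> #|cuts X| = 3 ->
  distance_sum X <= 84.
Proof.
move=> gX X7 diam cuts3.
have inX c : c \in cuts X -> c \in X by rewrite inE => /andP[].
have cut_adj c c' : c \in cuts X -> c' \in cuts X -> c != c' -> dist c c' = 1.
  rewrite !inE => cutc cutc' cc'; have := dist_cuts gX diam cutc cutc' cc'.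
  have : 0 < dist c c' by rewrite lt0n dist_eq0.
  by clear; lia.
have gap v e : v \in X -> (forall u, u \in X -> dist v u <= e) ->
    transmission X v + \sum_(u in X) (e - dist v u) = e * 7.
  move=> vX le_e; rewrite -X7 mulnC -sum_nat_const -big_split.
  by apply: eq_bigr => u uX /=; rewrite subnKC ?le_e.
have two c : exists c1 c2, [/\ c1 \in cuts X, c2 \in cuts X, c1 != c, c2 != c & c1 != c2].
  have : 1 < #|cuts X :\ c| by have := cardsD1 c (cuts X); rewrite cuts3; case: (c \in _); clear; lia.
  by case/card_gt1P=> c1 [c2 [/setD1P[? ?] /setD1P[? ?] ?]]; exists c1, c2.
have sum_ge (s : seq G) (F : G -> nat) : uniq s -> all (mem X) s ->
    \sum_(u <- s) F u <= \sum_(u in X) F u.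
  move=> Us /allP sX; rewrite -big_enum /= [leqRHS](perm_big (s ++ [seq u <- enum X | u \notin s])).
    by rewrite big_cat /= leq_addr.
  apply: uniq_perm (enum_uniq _) _ _.
    rewrite cat_uniq Us (filter_uniq _ (enum_uniq _)) andbT /=.
    by apply/hasPn => u; rewrite mem_filter => /andP[].
  move=> u; rewrite mem_enum mem_cat mem_filter mem_enum; have := sX u.
  by case: (u \in s) => //= ->.
have t_cut c : c \in cuts X -> transmission X c <= 9.
  move=> cC; have cX := inX c cC; have cutc : cut_in X c by rewrite inE in cC.
  have le2 u : u \in X -> dist c u <= 2.
    have [->|uc] := eqVneq u c; first by rewrite dist_xx.
    by move=> uX; rewrite dist_sym -ltnS (dist_cut gX diam).
  have [c1 [c2 [c1C c2C c1c c2c c12]]] := two c.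
  have [z [zX zc dz]] := cut_in_extend conG gX cutc (inX _ c1C) c1c.
  have d1 := cut_adj _ _ c1C cC c1c; have d2 := cut_adj _ _ c2C cC c2c.
  have cut1 : cut_in X c1 by rewrite inE in c1C.
  have cz : 0 < dist c z by rewrite lt0n dist_eq0 // eq_sym.
  have zc1 : z != c1 by apply: contraTneq cz => zc1; rewrite zc1 dist_xx d1 in dz.
  have zcut : z \notin cuts X.
    apply/negP => zC; have := cut_adj _ _ c1C zC; rewrite eq_sym => /(_ zc1).
    by move: dz cz; rewrite d1; clear; lia.
  have d1z : dist c1 z <= 2 by rewrite dist_sym -ltnS (dist_cut gX diam).
  (* The deficits 2 - dist are 2 at [c] and 1 at each of the other two cut vertices and at [z], so t
     <= 14 - 5. *)
  have := gap c 2 cX le2.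
  have := sum_ge [:: c; c1; c2; z] (fun u => 2 - dist c u).
  rewrite /= !inE !negb_or !(eq_sym c) c1c c2c zc c12 !(eq_sym _ z) zc1 cX zX !inX //=.
  have -> : z != c2 by apply: contraNneq zcut => ->.
  rewrite !big_cons big_nil dist_xx (dist_sym c c1) (dist_sym c c2) => /(_ isT isT).
  by move: d1 d2 dz d1z; clear; lia.
have t_other v : v \in X -> v \notin cuts X -> transmission X v <= 14.
  move=> vX vC; have le3 u : u \in X -> dist v u <= 3 by apply: diam.
  have := gap v 3 vX le3.
  pose N := [set u in X | dist v u == 1].
  (* The deficits 3 - dist add up to at least 7, so t <= 21 - 7. Two neighbours give 3 + 2 + 2. A
     single neighbour [w] is a cut vertex, and the other two lie at distance at most 2 from [v]: 3 +
     2 + 1 + 1. *)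
  have [N1|N1] := leqP #|N| 1; last first.
    case/card_gt1P: N1 => u1 [u2 [/setIdP[u1X /eqP d1] /setIdP[u2X /eqP d2] u12]].
    have := sum_ge [:: v; u1; u2] (fun u => 3 - dist v u).
    have nv u : dist v u = 1 -> v != u by move=> du; apply: contra_eq_neq du => <-; rewrite dist_xx.
    rewrite /= !inE negb_or u12 vX u1X u2X !nv //= !big_cons big_nil dist_xx d1 d2.
    by move=> /(_ isT isT); clear; lia.
  have [u uX uv] : exists2 u, u \in X & u != v.
    have : 0 < #|X :\ v| by have := cardsD1 v X; rewrite X7 vX; clear; lia.
    by case/card_gt0P=> u /setD1P[uv uX]; exists u.
  have [w wX dw] : exists2 w, w \in X & dist v w = 1.
    have [] := joined_crossing (i := 1) (dist_lip conG v) vX (geodesic_joined gX vX uX).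
      by rewrite dist_xx lt0n dist_eq0 // eq_sym.
    by move=> w; exists w.
  have vw : v != w by apply: contra_eq_neq dw => <-; rewrite dist_xx.
  have single x : x \in X -> dist v x = dist v w -> x = w.
    move=> xX; rewrite dw => dx; move/card_le1P: N1 => /(_ w).
    by rewrite inE wX dw eqxx => /(_ isT x); rewrite !inE xX dx eqxx => /esym/eqP.
  have wC : w \in cuts X.
    have : 0 < #|X :\ v :\ w|.
      by have := cardsD1 v X; have := cardsD1 w (X :\ v); rewrite !inE eq_sym vw wX vX X7; clear; lia.
    case/card_gt0P=> x /setD1P[xw /setD1P[xv xX]]; rewrite inE.
    apply: (single_layer_cut conG vX wX xX vw single).
    rewrite dw ltn_neqAle lt0n dist_eq0 // [v == x]eq_sym xv andbT.
    by apply: contraNneq xw => dx; apply/eqP/single; rewrite ?dw.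
  have [c1 [c2 [c1C c2C c1w c2w c12]]] := two w.
  have le2 c : c \in cuts X -> c != w -> dist v c <= 2.
    move=> cC cw; have := dist_triangle conG v w c.
    by rewrite dw (cut_adj w c wC cC) 1?eq_sym.
  have d1 := le2 _ c1C c1w; have d2 := le2 _ c2C c2w.
  have := sum_ge [:: v; w; c1; c2] (fun u => 3 - dist v u).
  have nv c : c \in cuts X -> v != c by move=> cC; apply: contraNneq vC => ->.
  rewrite /= !inE !negb_or vw !nv // !(eq_sym w) c1w c2w c12 vX wX !inX //=.
  by rewrite !big_cons big_nil dist_xx dw => /(_ isT isT); move: d1 d2; clear; lia.
rewrite /distance_sum (bigID (mem (cuts X))) /=.
have sumC : \sum_(v in X | v \in cuts X) transmission X v <= 3 * 9.
  rewrite (eq_bigl (mem (cuts X))) => [|v]; last first.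
    by rewrite /= andbC; case: (boolP (v \in cuts X)) => // /inX->.
  apply: (@leq_trans (#|cuts X| * 9)); last by rewrite cuts3.
  by rewrite -sum_nat_const; apply: leq_sum => c; apply: t_cut.
have sumN : \sum_(v in X | v \notin cuts X) transmission X v <= 4 * 14.
  apply: (@leq_trans (#|X :\: cuts X| * 14)).
    2: by rewrite cardsD (setIidPr _) ?X7 ?cuts3 //; apply/subsetP.
  rewrite -sum_nat_const (eq_bigl (mem (X :\: cuts X))) => [|v]; last by rewrite !inE andbC.
  by apply: leq_sum => v; rewrite !inE => /andP[vC vX]; apply: t_other; rewrite ?inE.
by have := leq_add sumC sumN; clear; lia.
Qed.

End SevenVertices.

(** * Comparison with the cycle *)

Lemma double_wiener (H : sgraph) : 2 * wiener H = distance_sum [set: H].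
Proof.
have -> : distance_sum [set: H] = \sum_(x : H) \sum_(y : H) dist x y.
  apply: eq_big => [x|x _]; first by rewrite inE.
  by apply: eq_bigl => y; rewrite inE.
transitivity (wiener H + \sum_(x : H) \sum_(y : H | enum_rank y < enum_rank x) dist x y).
  rewrite mul2n -addnn; congr (_ + _); rewrite /wiener.
  rewrite (exchange_big_dep xpredT) //=; apply: eq_bigr => x _; apply: eq_bigr => y _.
  exact: dist_sym.
rewrite -big_split; apply: eq_bigr => x _ /=.
rewrite [RHS](bigID (fun y : H => enum_rank x < enum_rank y)) /=; congr (_ + _).
rewrite [RHS](bigD1 x) ?ltnn //= dist_xx add0n; apply: eq_bigl => y.
rewrite -leqNgt ltn_neqAle andbC; congr (_ && _); congr (~~ _).
by apply/eqP/eqP => [/val_inj/enum_rank_inj|->].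
Qed.

Lemma cut_in_setT (H : sgraph) (w : H) : cut_in [set: H] w -> cut_vertex w.
Proof.
case/andP=> _ /existsP[x /andP[xw /existsP[y /andP[yw]]]]; apply: contra => con.
have [xW yW] : x \in [set~ w] /\ y \in [set~ w].
  by move: xw yw; rewrite !inE !andbT.
have /forallP/(_ (Sub x xW))/forallP/(_ (Sub y yW))/connectP[p xp yp] := con.
suff walk (q : seq (induced [set~ w])) u :
    path (@adj (induced [set~ w])) u q -> joined ([set: H] :\ w) (val u) (val (last u q)).
  by have := walk _ _ xp; rewrite -yp.
elim: q u {xp yp} => [|z q IHq] u /=; first by rewrite /joined connect0.
case/andP=> uz /IHq; apply: connect_trans; apply: connect1.
by have := valP u; have := valP z; rewrite /= !inE !andbT => -> ->.
Qed.

(** Along a walk from [x], [f] gains at most one per edge. The bound by [#|H|] covers the default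
    value of [dist] when there is no walk. *)
Lemma le_dist (H : sgraph) (x y : H) (f : H -> nat) :
  (forall u v, adj u v -> f v <= (f u).+1) -> f x = 0 -> f y <= #|H| -> f y <= dist x y.
Proof.
move=> f_lip fx0 fy.
have [hw|no_walk] := boolP (has (has_walk x y) (iota 0 #|H|)); last first.
  by rewrite /dist hasNfind // size_iota.
have lt_dist : dist x y < #|H| by move: hw; rewrite has_find size_iota.
have := nth_find 0 hw; rewrite -/(dist x y) nth_iota // add0n.
case/has_walkP => p [xp <- <-]; rewrite -[leqRHS]addn0 -fx0.
elim: p x xp {fx0 fy hw lt_dist} => //= z p IHp x /andP[xz /IHp le_p].
by apply: leq_trans le_p _; have := f_lip _ _ xz; rewrite addSnnS leq_add2l.
Qed.

(** Both halves of the range contribute 1 + ... + d. *)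
Lemma sum_minn_complement d : \sum_(k < (2 * d).+1) minn k ((2 * d).+1 - k) = d * d.+1.
Proof.
rewrite -(big_mkord xpredT (fun k => minn k ((2 * d).+1 - k))).
rewrite (@big_cat_nat _ _ _ d.+1) //=; last by rewrite ltnS; lia.
rewrite (eq_big_nat _ _ (F2 := fun k => k)) => [|k kd]; last by lia.
rewrite -{2}[d.+1]add1n big_addn.
have -> : (2 * d).+1 - d = d.+1 by lia.
rewrite [X in _ + X](eq_big_nat _ _ (F2 := fun k => d.+1 - k)) => [|k kd]; last by lia.
rewrite sum_bonus; have := bonusE (leqnSn d).
have : 2 * \sum_(0 <= k < d.+1) k = d * d.+1.
  by elim: (d) => [|d' IHd]; rewrite ?big_nat1 // big_nat_recr //= mulnDr IHd; lia.
lia.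
Qed.

Lemma ordS_Zp m (u : 'I_m.+2) : ordS u = (u + 1)%R.
Proof. by apply: val_inj; rewrite /= modnDmr addn1. Qed.

(** The length [F (v - i)] of the shorter arc is a potential as in [le_dist], and translating by [i]
    turns each transmission bound into [sum_minn_complement]. *)
Lemma distance_sum_cycle d : 0 < d ->
  (2 * d).+1 * (d * d.+1) <= distance_sum [set: cycle_graph (2 * d).+1].
Proof.
(* The order is put in the form [m.+2], for which [ordS] is adding 1 modulo the order
   ([ordS_Zp]). *)
case: d => // d _; have nE : (2 * d.+1).+1 = (2 * d).+3 by lia.
pose F (k : nat) := minn k ((2 * d).+3 - k).
rewrite nE; set H := cycle_graph _.
have F_lip (i u v : H) : adj u v -> F (v - i)%R <= (F (u - i)%R).+1.
  have F_succ (k : 'I_(2 * d).+3) : F (k + 1)%R <= (F k).+1 /\ F k <= (F (k + 1)%R).+1.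
    have := ltn_ord k; rewrite /F /= modnDmr leq_eqVlt => /orP[/eqP kn|lt_k].
      by rewrite addn1 kn modnn; lia.
    by rewrite modn_small ?addn1 //; lia.
  case/andP=> _; rewrite !ordS_Zp => /orP[]/eqP <-; rewrite GRing.addrAC.
    by case: (F_succ (u - i)%R).
  by case: (F_succ (v - i)%R).
rewrite -sum_minn_complement nE -[X in X * _](card_ord (2 * d).+3) -cardsT -sum_nat_const.
apply: leq_sum => i _.
rewrite (reindex_inj (GRing.addIr (- i)%R)) /=.
rewrite /transmission [leqRHS](eq_bigl xpredT) => [|j]; last by rewrite inE.
apply: leq_sum => j _; apply: (@le_dist H i j (fun v => F (v - i)%R)) => [u v||].
- exact: F_lip.
- by rewrite GRing.subrr.
- by rewrite card_ord /F geq_min; apply/orP; left; apply: ltnW.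
Qed.

Theorem theorem5p7 (n k : nat) (G : sgraph) (hn : 7 <= n) (odd_n : odd n)
    (hk : k <= 3) (hG : cut_vertex_family n k ((n - 1) %/ 2) G) :
  wiener G <= wiener (cycle_graph n).
Proof.
case: hG => conG cardG cutsG diamG.
pose d := (n - 1) %/ 2.
have nE : n = (2 * d).+1.
  by have := odd_double_half n; rewrite odd_n /d; lia.
have d3 : 3 <= d by lia.
rewrite nE -(leq_pmul2l (isT : 0 < 2)) !double_wiener.
apply: leq_trans (distance_sum_cycle (ltnW (ltnW d3))).
have gG := geodesic_setT conG.
have diam (x y : G) : x \in [set: G] -> y \in [set: G] -> dist x y <= d.
  move=> _ _; rewrite -[d]diamG; apply: leq_trans (leq_bigmax x).
  exact: (leq_bigmax (F := dist x) y).
have cuts3 : #|cuts [set: G]| <= 3.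
  rewrite (leq_trans _ hk) // -cutsG; apply: subset_leq_card.
  by apply/subsetP => w; rewrite !inE; apply: cut_in_setT.
have cardT : #|[set: G]| = (2 * d).+1 by rewrite cardsT -nE.
(* For d = 3, [total_le_diameter] admits two cut vertices; three are left to [distance_sum_seven],
   where 84 = 7 * 3 * 4. *)
have [/andP[/eqP d3' /eqP cuts3']|small] := boolP ((d == 3) && (#|cuts [set: G]| == 3)).
  rewrite d3' in cardT diam *; exact: distance_sum_seven.
apply: total_le_diameter => //; move: small cuts3; case: (d == 3) => //=.
by rewrite -[_ <= 2]ltnS ltn_neqAle => -> ->.
Qed.
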